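(* Let $\star$ be a nucleus on a precoherent semiprequantale (resp., precoherent near prequantale, precoherent prequantale) $Q$, and define $\star_f: Q\to Q$ by $x^{\star_f}=\bigvee\{y^\star: y\in\mathsf{K}(Q)\text{ and } y\le x\}$. Then $\star_f$ is the coarsest finitary nucleus on $Q$ that is finer than $\star$, the ordered magma $Q^{\star_f}$ is also a precoherent semiprequantale (resp., precoherent near prequantale, precoherent prequantale), and $\mathsf{K}(Q^{\star_f})=\mathsf{K}(Q)^{\star_f}$.
   Context: An ordered magma is a set $M$ with a binary operation (written multiplicatively, not assumed associative, commutative or unital) and a partial order such that $x\le x'$ and $y\le y'$ imply $xy\le x'y'$. A prequantale (resp., near prequantale, semiprequantale) is an ordered magma $Q$ such that for every subset (resp., every nonempty subset, every nonempty subset that is finite or bounded above) $X$ of $Q$, $\bigvee X$ exists and $a(\bigvee X)=\bigvee(aX)$, $(\bigvee X)a=\bigvee(Xa)$ for all $a\in Q$. A directed subset of a poset is a nonempty subset $\Delta$ such that every finite subset of $\Delta$ has an upper bound in $\Delta$. An element $x$ of a poset $S$ is compact if whenever $x\le\bigvee\Delta$ for a directed subset $\Delta$ of $S$ for which $\bigvee\Delta$ exists, one has $x\le y$ for some $y\in\Delta$; $\mathsf{K}(S)$ is the set of compact elements of $S$. An ordered magma $M$ is precoherent if every element of $M$ is the supremum of a set of compact elements and $\mathsf{K}(M)$ is closed under multiplication. For a self-map $\star$ of a set $S$ write $x^\star=\star(x)$ and $X^\star=\{x^\star:x\in X\}$ for $X\subset S$. A closure operation on a poset is an expansive ($x\le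 x^\star$), order-preserving, idempotent self-map. A nucleus on an ordered magma $M$ is a closure operation $\star$ with $x^\star y^\star\le (xy)^\star$ for all $x,y\in M$; the image $M^\star$ is then an ordered magma under the induced order and $\star$-multiplication $(x,y)\mapsto(xy)^\star$. A closure operation $\star$ on a poset $S$ is finitary if $(\bigvee\Delta)^\star=\bigvee(\Delta^\star)$ for every directed $\Delta\subset S$ for which $\bigvee\Delta$ exists. If $x^{\star_1}\le x^{\star_2}$ for all $x$, then $\star_1$ is said to be finer than $\star_2$ and $\star_2$ coarser than $\star_1$. *)

(* Defs.v *)
From HB Require Import structures.
From mathcomp Require Import all_boot all_order.
From mathcomp Require Import boolp classical_sets cardinality.

Set Implicit Arguments.
Unset Strict Implicit.
Unset Printing Implicit Defensive.

Local Open Scope classical_set_scope.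
Local Open Scope group_scope.
Local Open Scope order_scope.

HB.mixin Record isOrderedMagma (d : Order.disp_t) M
    of Order.POrder d M & Magma M := {
  omulS : forall x x' y y' : M,
    (x <= x')%O -> (y <= y')%O -> (x * y <= x' * y')%O
}.

#[short(type="omagmaType")]
HB.structure Definition OrderedMagma (d : Order.disp_t) :=
  {M of Order.POrder d M & Magma M & isOrderedMagma d M}.

Section Posets.
Context (d : Order.disp_t) (S : porderType d).
Implicit Types (x y : S) (D F : set S) (f g : S -> S).

Definition directed D : Prop :=
  D !=set0 /\
  forall F, finite_set F -> F `<=` D -> exists2 u, D u & ubound F u.

Definition compact_elements : set S :=
  [set x | forall D s, directed D -> isLub D s -> (x <= s)%O ->
           exists2 y, D y & (x <= y)%O].

Definition is_closure f : Prop :=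
  [/\ forall x, (x <= f x)%O,
      forall x y, (x <= y)%O -> (f x <= f y)%O &
      forall x, f (f x) = f x].

Definition finitary f : Prop :=
  forall D s, directed D -> isLub D s -> isLub (f @` D) (f s).

(* [f] is finer than [g], i.e. [g] is coarser than [f] *)
Definition finer f g : Prop := forall x, (f x <= g x)%O.

End Posets.

Arguments compact_elements {d} S.

Section OrderedMagmas.
Context (d : Order.disp_t) (M : omagmaType d).
Implicit Types (a s x y : M) (X : set M).

Definition distributive_lub X : Prop :=
  exists s, isLub X s /\
    forall a, isLub [set a * x | x in X] (a * s) /\
              isLub [set x * a | x in X] (s * a).

Definition prequantale : Prop := forall X, distributive_lub X.

Definition near_prequantale : Prop :=
  forall X, X !=set0 -> distributive_lub X.

Definition semiprequantale : Prop :=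
  forall X, X !=set0 -> finite_set X \/ has_ubound X -> distributive_lub X.

Definition precoherent : Prop :=
  (forall x, exists X, X `<=` compact_elements M /\ isLub X x) /\
  (forall x y, compact_elements M x -> compact_elements M y ->
     compact_elements M (x * y)).

Definition is_nucleus (f : M -> M) : Prop :=
  is_closure f /\ forall x y, (f x * f y <= f (x * y))%O.

Record nucleus := Nucleus {
  nucleus_fun :> M -> M;
  nucleusP : is_nucleus nucleus_fun
}.

(* [supremum] returns the least upper bound when there is one, and an
   unspecified element of [M] (built from the default [x]) otherwise. *)
Definition finitary_part (f : M -> M) : M -> M := fun x =>
  supremum x [set f y | y in [set y | compact_elements M y /\ (y <= x)%O]].

End OrderedMagmas.

Arguments prequantale {d} M.
Arguments near_prequantale {d} M.
Arguments semiprequantale {d} M.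
Arguments precoherent {d} M.
Arguments nucleus {d} M.

Variant prequantale_kind := Semiprequantale | NearPrequantale | Prequantale.

Definition is_kind (k : prequantale_kind) d (M : omagmaType d) : Prop :=
  match k with
  | Semiprequantale => semiprequantale M
  | NearPrequantale => near_prequantale M
  | Prequantale => prequantale M
  end.

Section NucleusImage.
Context (d : Order.disp_t) (M : omagmaType d) (f : nucleus M).

Definition nucleus_image : Type := {x : M | x \in range f}.

HB.instance Definition _ := [isSub of nucleus_image for @sval _ _].
HB.instance Definition _ := [Choice of nucleus_image by <:].
HB.instance Definition _ :=
  [SubChoice_isSubPOrder of nucleus_image by <: with d].

Definition nucleus_mul (x y : nucleus_image) : nucleus_image :=
  exist _ (f (\val x * \val y)) (mem_set (imageT f (\val x * \val y))).

HB.instance Definition _ := hasMul.Build nucleus_image nucleus_mul.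

Fact nucleus_omulS (x x' y y' : nucleus_image) :
  (x <= x')%O -> (y <= y')%O -> (x * y <= x' * y')%O.
Proof.
rewrite -!(Order.le_val (s := nucleus_image)) => xx' yy'.
by case: (nucleusP f) => -[_ mono _] _; apply/mono/omulS.
Qed.

HB.instance Definition _ := isOrderedMagma.Build d nucleus_image nucleus_omulS.

End NucleusImage.

(* Main.v *)
Require Import Defs.
From mathcomp Require Import all_boot all_order.
From mathcomp Require Import boolp classical_sets cardinality.

Set Implicit Arguments.
Unset Strict Implicit.
Unset Printing Implicit Defensive.

Import Order.TTheory.

Local Open Scope classical_set_scope.

(** Everything rests on two facts: every [x] is the supremum of the directed
    set of compact elements below it, and a compact [y] below
    [x^{star_f}], itself a directed supremum, is already below some [z^star]
    with [z <= x] compact. The first gives finitarity, the second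
    idempotence, and distributivity over these suprema gives the nucleus
    inequality. Finitarity makes directed suprema in [Q^{star_f}] agree with those in [Q], so that
    [star_f] maps compact elements to compact elements. *)

(** * Least upper bounds, directed sets and compact elements *)

Section Lubs.
Context (d : Order.disp_t) (S : porderType d).
Implicit Types (x y s t : S) (A D : set S).

Lemma isLub_unique A s t : isLub A s -> isLub A t -> s = t.
Proof.
by move=> [us ls] [ut lt]; apply/le_anti; rewrite (ls _ ut) (lt _ us).
Qed.

(** On the empty set [supremum] falls back on its default [x], whence the nonemptiness
    hypothesis. *)
Lemma isLub_supremum x A s : A !=set0 -> isLub A s -> isLub A (supremum x A).
Proof.
move=> /set0P/negbTE A0 As; rewrite /supremum A0.
by apply: (@xgetPex _ x (supremums A)); exists s.
Qed.

Lemma pairwise_directed D : D !=set0 ->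
  (forall x y, D x -> D y -> exists u, [/\ D u, (x <= u)%O & (y <= u)%O]) ->
  directed D.
Proof.
move=> D0 D2; split=> // F /finite_seqP[r ->{F}].
elim: r => [_|x r IHr sub]; first by case: D0 => u Du; exists u.
have [y ry|u Du ru] := IHr; first by apply: sub => /=; rewrite inE ry orbT.
have [|v [Dv xv uv]] := D2 x u _ Du.
  by apply: sub => /=; rewrite inE eqxx.
exists v => // y /=; rewrite inE => /orP[/eqP -> //|ry].
exact: le_trans (ru _ ry) uv.
Qed.

Lemma directed_pair D x y : directed D -> D x -> D y ->
  exists u, [/\ D u, (x <= u)%O & (y <= u)%O].
Proof.
move=> [_ Dd] Dx Dy.
have [||u Du uub] := Dd [set` [:: x; y]]; first exact: finite_seq.
  by move=> z /=; rewrite !inE => /orP[]/eqP ->.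
by exists u; split=> //; apply: uub; rewrite /= !inE eqxx ?orbT.
Qed.

(** Members of a directed set above [x] and [y] have a common bound in it, and that bound dominates
    the join. *)
Lemma compact_join x y s : compact_elements S x -> compact_elements S y ->
  isLub [set x; y] s -> compact_elements S s.
Proof.
move=> Kx Ky [us ls] D t Dd Dt st.
have xs : (x <= s)%O by apply: us; left.
have ys : (y <= s)%O by apply: us; right.
have [a Da xa] := Kx D t Dd Dt (le_trans xs st).
have [b Db yb] := Ky D t Dd Dt (le_trans ys st).
have [u [Du au bu]] := directed_pair Dd Da Db.
by exists u => //; apply: ls => z [|] ->;
  [exact: le_trans xa au|exact: le_trans yb bu].
Qed.

Lemma bottom_compact x : (forall y, (x <= y)%O) -> compact_elements S x.
Proof. by move=> x0 D s [[y Dy] _] _ _; exists y. Qed.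

End Lubs.

Lemma directed_image d d' (S : porderType d) (T : porderType d') (g : S -> T)
    (D : set S) :
  {homo g : x y / (x <= y)%O} -> directed D -> directed (g @` D).
Proof.
move=> gS Dd; apply: pairwise_directed.
  by have [[x Dx] _] := Dd; exists (g x), x.
move=> _ _ [x Dx <-] [y Dy <-].
have [u [Du xu yu]] := directed_pair Dd Dx Dy.
by exists (g u); split; [exists u|exact: gS|exact: gS].
Qed.

(** * The image of a nucleus as an ordered magma *)

Section NucleusImageTheory.
Local Open Scope group_scope.
Context (d : Order.disp_t) (M : omagmaType d) (f : nucleus M).
Implicit Types (x y : M) (u v : nucleus_image f) (X : set (nucleus_image f)).

Lemma nucleus_ge x : (x <= f x)%O.
Proof. by have [[]] := nucleusP f. Qed.

Lemma nucleus_homo : {homo f : x y / (x <= y)%O}.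
Proof. by have [[]] := nucleusP f. Qed.

Lemma nucleus_id x : f (f x) = f x.
Proof. by have [[]] := nucleusP f. Qed.

Lemma nucleus_mulS x y : (f x * f y <= f (x * y))%O.
Proof. by have [_] := nucleusP f. Qed.

Lemma nucleus_mul_id x y : f (f x * f y) = f (x * y).
Proof.
apply/le_anti/andP; split.
  by rewrite -(nucleus_id (x * y)); apply/nucleus_homo/nucleus_mulS.
by apply/nucleus_homo/omulS; apply: nucleus_ge.
Qed.

Definition to_image x : nucleus_image f := exist _ (f x) (mem_set (imageT f x)).

Lemma image_leE u v : (u <= v)%O = (val u <= val v)%O.
Proof. by rewrite -(Order.le_val (s := nucleus_image f)). Qed.

Lemma nucleus_val u : f (val u) = val u.
Proof. by case: u => x /= /set_mem[y _ <-]; rewrite nucleus_id. Qed.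

Lemma to_imageK u : to_image (val u) = u.
Proof. by apply/val_inj/nucleus_val. Qed.

Lemma to_image_homo : {homo to_image : x y / (x <= y)%O}.
Proof. by move=> x y xy; rewrite image_leE; apply: nucleus_homo. Qed.

(** An adjunction: [to_image] is left adjoint to [val], hence preserves all existing suprema. *)
Lemma to_image_le x u : (to_image x <= u)%O = (x <= val u)%O.
Proof.
rewrite image_leE /=; apply/idP/idP; first exact/le_trans/nucleus_ge.
by rewrite -{2}(nucleus_val u); apply: nucleus_homo.
Qed.

Lemma to_imageM x y : (to_image x * to_image y) = to_image (x * y).
Proof. by apply/val_inj/nucleus_mul_id. Qed.

Lemma to_image_mull x u : to_image (x * val u) = (to_image x * u).
Proof. by rewrite -{2}(to_imageK u) to_imageM. Qed.

Lemma to_image_mulr x u : to_image (val u * x) = (u * to_image x).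
Proof. by rewrite -{2}(to_imageK u) to_imageM. Qed.

Lemma to_image_isLub (A : set M) s :
  isLub A s -> isLub (to_image @` A) (to_image s).
Proof.
move=> [us ls]; split=> [_ [x Ax <-]|u uub]; first exact/to_image_homo/us.
rewrite to_image_le; apply: ls => x Ax; rewrite -to_image_le.
by apply: uub; exists x.
Qed.

Lemma to_image_val X : to_image @` (val @` X) = X.
Proof.
rewrite image_comp (_ : _ \o _ = id) ?image_id //.
by apply/funext => u; apply: to_imageK.
Qed.

Lemma nucleus_image_val X : f @` (val @` X) = val @` X.
Proof. by rewrite image_comp; apply: eq_imagel => u _; apply: nucleus_val. Qed.

(** The multiplicative map [to_image] preserves suprema, so it carries the supremum in [M] and its
    distributive laws over to the image. *)
Lemma image_distributive_lub X :
  distributive_lub (val @` X) -> distributive_lub X.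
Proof.
move=> [s [Xs sM]]; exists (to_image s); split.
  by rewrite -{1}(to_image_val X); apply: to_image_isLub.
move=> u; have [/to_image_isLub ul /to_image_isLub ur] := sM (val u).
rewrite -to_image_mulr -to_image_mull; split.
  rewrite (_ : [set _ | _ in _] = to_image @` [set val u * x | x in val @` X])
    //.
  rewrite !image_comp; apply: eq_imagel => v _ /=.
  by rewrite to_image_mulr to_imageK.
rewrite (_ : [set _ | _ in _] = to_image @` [set x * val u | x in val @` X]) //.
rewrite !image_comp; apply: eq_imagel => v _ /=.
by rewrite to_image_mull to_imageK.
Qed.

(** [val] preserves nonemptiness, finiteness and boundedness, so the conditions on a subset of the
    image pass to its copy in [M]. *)
Lemma image_is_kind k : is_kind k M -> is_kind k (nucleus_image f).
Proof.
have image0 X : X !=set0 -> val @` X !=set0.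
  by move=> [u Xu]; exists (val u), u.
case: k => /= MQ X.
- move=> X0 Xfb; apply/image_distributive_lub/MQ; first exact: image0.
  case: Xfb => [Xf|[u uub]]; [left; exact: finite_image|right].
  by exists (val u) => _ [v Xv <-]; rewrite -image_leE; apply: uub.
- by move=> X0; apply/image_distributive_lub/MQ/image0.
- exact/image_distributive_lub/MQ.
Qed.

End NucleusImageTheory.

(** The semiprequantale law is the weakest of the three; all claims except the kind of the image are
    derived from it. *)
Lemma is_kind_semiprequantale k d (M : omagmaType d) :
  is_kind k M -> semiprequantale M.
Proof. by case: k => //= MQ X X0 _; apply: MQ. Qed.

(** * The finitary part of a nucleus *)

Section FinitaryPart.
Local Open Scope group_scope.
Context (d : Order.disp_t) (Q : omagmaType d).
Context (Qs : semiprequantale Q) (Qc : precoherent Q).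
Implicit Types (x y z : Q) (D : set Q).

Let below x := [set y | compact_elements Q y /\ (y <= x)%O].

(** Binary joins exist by the semiprequantale law, and joins of compact elements are compact. *)
Lemma below_directed x : directed (below x).
Proof.
apply: pairwise_directed => [|y z [Ky yx] [Kz zx]].
  have [X [XK [Xx lx]]] := Qc.1 x.
  have [X0|/set0P[y Xy]] := eqVneq X set0; last first.
    by exists y; split; [exact: XK|exact: Xx].
  (* As the supremum of the empty set, [x] is the least element, hence compact. *)
  by exists x; split=> //; apply: bottom_compact => y; apply: lx;
    rewrite X0 => z [].
have [||s [ls _]] := Qs (X := [set y; z]); first by exists y; left.
  by left; apply: finite_set2.
exists s; split; last by apply: ls.1; right.
  split; first exact: compact_join Ky Kz ls.
  by apply: ls.2 => w [] ->.
by apply: ls.1; left.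
Qed.

Lemma below_isLub x : isLub (below x) x.
Proof.
split=> [y []//|u uub]; have [X [XK Xx]] := Qc.1 x.
by apply: Xx.2 => y Xy; apply: uub; split; [exact: XK|exact: Xx.1].
Qed.

Context (star : nucleus Q).

Let f := finitary_part star.

Let star_below_ne x : star @` below x !=set0.
Proof. by have [[y yx] _] := below_directed x; exists (star y), y. Qed.

(** [star x] bounds this set, so the semiprequantale law applies to it. *)
Let star_below_distr x : distributive_lub (star @` below x).
Proof.
apply: Qs => //; right; exists (star x) => _ [y [_ yx] <-].
exact: nucleus_homo.
Qed.

Lemma finitary_part_isLub x : isLub (star @` below x) (f x).
Proof. by have [s [ls _]] := star_below_distr x; apply: isLub_supremum ls. Qed.

Lemma finitary_part_ub x y : compact_elements Q y -> (y <= x)%O ->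
  (star y <= f x)%O.
Proof. by move=> Ky yx; apply: (finitary_part_isLub x).1; exists y. Qed.

Lemma finitary_part_le x z :
  (forall y, compact_elements Q y -> (y <= x)%O -> (star y <= z)%O) ->
  (f x <= z)%O.
Proof.
by move=> H; apply: (finitary_part_isLub x).2 => _ [y [Ky yx] <-]; apply: H.
Qed.

Lemma finitary_part_finer : finer f star.
Proof. by move=> x; apply: finitary_part_le => y _; apply: nucleus_homo. Qed.

Lemma finitary_part_homo : {homo f : x y / (x <= y)%O}.
Proof.
move=> x y xy; apply: finitary_part_le => z Kz zx.
exact: finitary_part_ub Kz (le_trans zx xy).
Qed.

Lemma compact_le_finitary_part x y : compact_elements Q y -> (y <= f x)%O ->
  exists z, [/\ compact_elements Q z, (z <= x)%O & (y <= star z)%O].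
Proof.
move=> Ky yfx.
have Dd := directed_image (@nucleus_homo _ _ star) (below_directed x).
have [_ [z [Kz zx] <-] yz] := Ky _ _ Dd (finitary_part_isLub x) yfx.
by exists z.
Qed.

Lemma finitary_part_nucleus : is_nucleus f.
Proof.
split; first split.
- move=> x; apply: (below_isLub x).2 => y [Ky yx].
  exact: le_trans (nucleus_ge star y) (finitary_part_ub Ky yx).
- exact: finitary_part_homo.
- move=> x; apply/le_anti/andP; split; apply: finitary_part_le => y Ky yx.
    have [z [Kz zx yz]] := compact_le_finitary_part Ky yx.
    apply: le_trans (finitary_part_ub Kz zx).
    by rewrite -(nucleus_id star z); apply: nucleus_homo.
  apply: (finitary_part_ub Ky).
  exact: le_trans (nucleus_ge star y) (finitary_part_ub Ky yx).
- move=> x y.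
  have distr z : forall a, isLub [set a * w | w in star @` below z] (a * f z) /\
      isLub [set w * a | w in star @` below z] (f z * a).
    have [s [ls sM]] := star_below_distr z.
    by rewrite (isLub_unique (finitary_part_isLub z) ls).
  (* Distributivity, first in the left factor and then in the right, reduces the claim to
     [star z * star w] with [z <= x] and [w <= y] compact. *)
  apply: (distr x (f y)).2.2 => _ [_ [z [Kz zx] <-] <-].
  apply: (distr y (star z)).1.2 => _ [_ [w [Kw wy] <-] <-].
  apply: le_trans (nucleus_mulS star z w) _.
  by apply: finitary_part_ub; [exact: Qc.2|exact: omulS].
Qed.

(** A compact element below the supremum of [D] lies below some [x] in [D], so its [star] is at most
    [f x]. *)
Lemma finitary_part_finitary : finitary f.
Proof.
move=> D s Dd Ds; split=> [_ [x Dx <-]|u uub].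
  exact/finitary_part_homo/Ds.1.
apply: finitary_part_le => y Ky ys.
have [x Dx yx] := Ky D s Dd Ds ys.
by apply: le_trans (finitary_part_ub Ky yx) _; apply: uub; exists x.
Qed.

(** By finitarity, [g x] is the supremum of the values [g y <= star y] over compact [y <= x]. *)
Lemma finitary_part_coarsest (g : nucleus Q) :
  finitary g -> finer g star -> finer g f.
Proof.
move=> gf gs x; apply: (gf _ _ (below_directed x) (below_isLub x)).2.
by move=> _ [y [Ky yx] <-]; apply: le_trans (gs y) (finitary_part_ub Ky yx).
Qed.

End FinitaryPart.

(** * Compact elements in the image of a finitary nucleus *)

Section FinitaryNucleus.
Local Open Scope group_scope.
Context (d : Order.disp_t) (Q : omagmaType d).
Context (Qs : semiprequantale Q) (Qc : precoherent Q).
Context (g : nucleus Q) (gf : finitary g).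

Lemma to_image_compact y :
  compact_elements Q y -> compact_elements (nucleus_image g) (to_image g y).
Proof.
move=> Ky D s Dd Ds; rewrite to_image_le => ys.
have vDd : directed (val @` D).
  by apply: directed_image Dd => u v; rewrite -image_leE.
(* [val s] is an upper bound, so the supremum [t] of [D] taken in [Q] exists. *)
have [||t [Dt _]] := Qs (X := val @` D); first exact: vDd.1.
  by right; exists (val s) => _ [u Du <-]; rewrite -image_leE; apply: Ds.1.
have st : s = to_image g t.
  apply: isLub_unique Ds _.
  by rewrite -(to_image_val D); apply: to_image_isLub.
(* Since [g] fixes the members of [D], finitarity makes it fix their directed supremum, so [t] is
   also the supremum in the image. *)
have gt : g t = t.
  by have := gf vDd Dt; rewrite nucleus_image_val => /isLub_unique; apply.
have yt : (y <= t)%O by rewrite -gt; rewrite st in ys.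
have [_ [u Du <-] yu] := Ky _ _ vDd Dt yt.
by exists u => //; rewrite to_image_le.
Qed.

Lemma image_lub_compact (u : nucleus_image g) :
  isLub (to_image g @` [set y | compact_elements Q y /\ (y <= val u)%O]) u.
Proof.
by rewrite -{2}(to_imageK u); apply: to_image_isLub; apply: below_isLub.
Qed.

(** A compact [u] is the directed supremum of the [to_image y] with [y] compact below [val u];
    compactness applied to [u <= u] makes it equal to one of them. *)
Lemma compact_elements_image :
  compact_elements (nucleus_image g) = to_image g @` compact_elements Q.
Proof.
apply/seteqP; split=> [u Ku|_ [y Ky <-]]; last exact: to_image_compact.
have Dd := directed_image (@to_image_homo _ _ g) (below_directed Qs Qc (val u)).
have [_ [y [Ky yu] <-] uy] := Ku _ _ Dd (image_lub_compact u) (lexx u).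
by exists y => //; apply/le_anti; rewrite uy to_image_le yu.
Qed.

Lemma image_precoherent : precoherent (nucleus_image g).
Proof.
split=> [u|u v].
  exists (to_image g @` [set y | compact_elements Q y /\ (y <= val u)%O]).
  split; last exact: image_lub_compact.
  by move=> _ [y [Ky _] <-]; apply: to_image_compact.
rewrite compact_elements_image => -[x Kx <-] [y Ky <-].
by rewrite to_imageM; exists (x * y) => //; apply: Qc.2.
Qed.

End FinitaryNucleus.

Theorem theorem6p6 (k : prequantale_kind) (d : Order.disp_t)
    (Q : omagmaType d) (star : nucleus Q) :
  is_kind k Q -> precoherent Q ->
  (forall x : Q,
     isLub [set star y | y in [set y | compact_elements Q y /\ (y <= x)%O]]
           (finitary_part star x)) /\
  exists nuc : is_nucleus (finitary_part star),
    let star_f := Nucleus nuc in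
    [/\ finitary star_f /\ finer star_f star,
        forall s : nucleus Q, finitary s -> finer s star -> finer s star_f,
        is_kind k (nucleus_image star_f),
        precoherent (nucleus_image star_f) &
        val @` compact_elements (nucleus_image star_f) =
        star_f @` compact_elements Q].
Proof.
move=> Qk Qc; have Qs := is_kind_semiprequantale Qk.
(* This certifies that [supremum] returns a genuine least upper bound here. *)
split; first exact: finitary_part_isLub.
exists (finitary_part_nucleus Qs Qc star) => star_f.
have ff : finitary star_f by apply: finitary_part_finitary.
split.
- by split=> //; apply: finitary_part_finer.
- exact: finitary_part_coarsest.
- exact: image_is_kind.
- exact: image_precoherent.
- by rewrite (compact_elements_image Qs Qc ff) image_comp.
Qed.
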